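(* For every integer $n \ge 0$, let $e(n)$ be the number of integer partitions of $n$ that do not contain their own length (number of parts) as a part, and let $f(n)$ be the sum, over all partitions $\lambda$ of $2n+2$ with rank $n+1$, of the number of different part sizes appearing in $\lambda$. Then $$e(n) = p(n) - p(n-1) + p(n-2) = f(n).$$
   Context: An integer partition of $n$ is a weakly decreasing finite sequence $\lambda = (\lambda_1, \lambda_2, \ldots, \lambda_m)$ of positive integers summing to $n$; its length is $\ell(\lambda) = m$ and its size is $|\lambda| = n$. The number of partitions of $n$ is denoted $p(n)$, with $p(0)=1$ (the empty partition, which has length $0$ and does not contain $0$ as a part) and $p(k)=0$ for $k<0$. In the definition of $e(n)$ the partitions are unrestricted (parts may be repeated), and a partition $\lambda$ is counted exactly when no part $\lambda_i$ equals $\ell(\lambda)$. The rank of a nonempty partition is its largest part minus its number of parts, $\lambda_1 - \ell(\lambda)$. The number of part sizes of $\lambda$ is the number of distinct integers occurring among its parts (counted without multiplicity). *)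

(* Defs.v *)
From HB Require Import structures.
From mathcomp Require Import all_boot all_order all_algebra.

Set Implicit Arguments.
Unset Strict Implicit.
Unset Printing Implicit Defensive.

Import Order.TTheory GRing.Theory Num.Theory.

Definition is_part_of (n : nat) (s : seq nat) : bool :=
  [&& sorted geq s, all (ltn 0) s & sumn s == n].

Record intpart (n : nat) : Type := IntPart {
  parts :> seq nat;
  partsP : is_part_of n parts
}.

HB.instance Definition _ (n : nat) := [isSub for @parts n].
HB.instance Definition _ (n : nat) := [Countable of intpart n by <:].

(* Finiteness: a partition of n has at most n parts, all of them at most n. *)

Lemma size_le_sumn (s : seq nat) : all (ltn 0) s -> size s <= sumn s.
Proof. by elim: s => //= x s IHs /andP[x_gt0 /IHs]; apply: leq_add x_gt0. Qed.

Lemma mem_le_sumn (s : seq nat) (x : nat) : x \in s -> x <= sumn s.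
Proof.
elim: s => //= y s IHs; rewrite inE => /orP[/eqP->|/IHs le_xs].
  exact: leq_addr.
exact: leq_trans le_xs (leq_addl _ _).
Qed.

Lemma size_intpart (n : nat) (l : intpart n) : size l <= n.
Proof. by case: l => s /= /and3P[_ s_gt0 /eqP<-]; apply: size_le_sumn. Qed.

Lemma mem_intpart_le (n : nat) (l : intpart n) (x : nat) : x \in parts l -> x <= n.
Proof. by case: l => s /= /and3P[_ _ /eqP<-]; apply: mem_le_sumn. Qed.

Lemma size_map_inord (n : nat) (l : intpart n) :
  size (map (@inord n) l) <= n.
Proof. by rewrite size_map size_intpart. Qed.

Definition bseq_of_intpart (n : nat) (l : intpart n) : n.-bseq 'I_n.+1 :=
  Bseq (size_map_inord l).

Definition intpart_of_bseq (n : nat) (b : n.-bseq 'I_n.+1) :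
    option (intpart n) :=
  insub (map (@nat_of_ord n.+1) b).

Lemma bseq_of_intpartK (n : nat) :
  pcancel (@bseq_of_intpart n) (@intpart_of_bseq n).
Proof.
move=> l; rewrite /intpart_of_bseq /= -map_comp map_id_in; first exact: valK.
by move=> x /mem_intpart_le le_xn /=; rewrite inordK.
Qed.

HB.instance Definition _ (n : nat) : isFinite (intpart n) :=
  PCanIsFinite (@bseq_of_intpartK n).

Definition pnum (k : int) : nat :=
  match k with
  | Posz m => #|{: intpart m}|
  | Negz _ => 0
  end.

(* The rank is integer-valued, since it can be negative; on the empty
   partition it is the junk value 0. *)
Definition rank (n : nat) (l : intpart n) : int :=
  ((head 0%N l)%:Z - (size l)%:Z)%R.

Definition num_part_sizes (n : nat) (l : intpart n) : nat := size (undup l).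

Definition e (n : nat) : nat := #|[set l : intpart n | size l \notin parts l]|.

Definition f (n : nat) : nat :=
  \sum_(l : intpart (2 * n + 2) | rank l == (n%:Z + 1)%R) num_part_sizes l.

(* Main.v *)
Require Import Defs.
From mathcomp Require Import all_boot all_order all_algebra.
From mathcomp Require Import zify.

Set Implicit Arguments.
Unset Strict Implicit.
Unset Printing Implicit Defensive.

(** Everything is expressed through [q n] ([num_no1 n] below), the number of
partitions of [n] without a part equal to 1.  Deleting one part 1 is a
bijection from the partitions of [n + 1] containing 1 to the partitions of
[n], so [q (n + 1) = p(n + 1) - p(n)] ([num_no1S]), and summing telescopes to
[q 0 + ... + q n = p(n)] ([sum_num_no1]).

For [e], consider a partition of [n + 1] with [m] parts that does contain [m].
Deleting one part [m] leaves an arbitrary partition with [m - 1] parts, of size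
[n + 1 - m]; adding 1 to each of its parts gives a partition of [n] without 1,
and [m] is recovered from the number of parts ([num_own_length]).  Hence
[e (n + 1) = p(n + 1) - q n].

For [f], a partition of [2n + 2] with [m + 1] parts and rank [n + 1] has largest
part [n + m + 2], so the other [m] parts have sum [n - m].  Adding 1 to each of
these [m] parts gives an arbitrary partition of [n] without 1.  The largest
part exceeds the sum of the others, hence is a part size of its own, and
[f n] is the sum over the partitions [t] of [n] without 1 of 1 plus the number
of part sizes of [t] ([f_no1]).  Counting pairs of such a [t] and a part
[k >= 2] of [t], and deleting [k], the numbers of part sizes add up to the sum
of [q (n - k)] over [2 <= k <= n] ([sum_sizes_no1]), which is [p(n - 2)].
Therefore [f n = q n + p(n - 2) = p(n) - p(n - 1) + p(n - 2)]. *)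

(** * Reindexing sums over partitions *)

Lemma sum_intpart_seq n (P : pred (seq nat)) (h : seq nat -> nat) :
  \sum_(l : intpart n | P l) h l =
  \sum_(s <- [seq s <- [seq parts l | l : intpart n] | P s]) h s.
Proof. by rewrite big_filter big_map big_enum_cond. Qed.

Lemma mem_intpart_seq n s :
  (s \in [seq parts l | l : intpart n]) = is_part_of n s.
Proof.
apply/mapP/idP => [[l _ ->]|s_part]; first exact: partsP.
by exists (IntPart s_part); rewrite ?mem_enum.
Qed.

(** Stating the bijection on the underlying sequences allows [F] and [G] to be
plain total functions on lists, without building proofs that their values are
partitions inside the maps themselves. *)
Lemma sum_intpart_bij n m (P Q : pred (seq nat)) (F G : seq nat -> seq nat)
    (h k : seq nat -> nat) :
    (forall s, is_part_of n s -> P s ->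
       [/\ is_part_of m (F s), Q (F s), G (F s) = s & k (F s) = h s]) ->
    (forall t, is_part_of m t -> Q t ->
       [/\ is_part_of n (G t), P (G t) & F (G t) = t]) ->
  \sum_(l : intpart n | P l) h l = \sum_(l : intpart m | Q l) k l.
Proof.
move=> FP GP; rewrite !sum_intpart_seq.
set A := filter P _; set B := filter Q _.
have memA s : (s \in A) = P s && is_part_of n s.
  by rewrite mem_filter mem_intpart_seq.
have memB s : (s \in B) = Q s && is_part_of m s.
  by rewrite mem_filter mem_intpart_seq.
have uniq_parts d : uniq [seq parts l | l : intpart d].
  by rewrite map_inj_uniq ?enum_uniq //; apply: val_inj.
have FA : perm_eq (map F A) B.
  apply: uniq_perm; last 1 first.
  - move=> t; apply/mapP/idP => [[s + ->]|].
      by rewrite memA memB => /andP[Ps /FP/(_ Ps)[-> ->]].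
    by rewrite memB => /andP[Qt /GP/(_ Qt)[Gt PGt FGt]]; exists (G t);
      rewrite ?memA ?PGt.
  - rewrite map_inj_in_uniq ?filter_uniq // => s t.
    rewrite !memA => /andP[Ps /FP/(_ Ps)[_ _ + _]] /andP[Pt /FP/(_ Pt)[_ _ + _]].
    by move=> {2}<- {2}<- ->.
  - exact: filter_uniq.
rewrite -(perm_big _ FA) big_map; apply: eq_big_seq => s; rewrite memA => /andP[Ps].
by case/FP/(_ Ps).
Qed.

(** * Inserting and deleting a part *)

Lemma geq_sorted_eq s t :
  sorted geq s -> sorted geq t -> perm_eq s t -> s = t.
Proof.
apply: sorted_eq => [x y z yx zx|x y]; first exact: leq_trans zx yx.
by rewrite andbC -eqn_leq => /eqP.
Qed.

Definition insert_part x s := sort geq (x :: s).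

Lemma perm_insert_part x s : perm_eq (insert_part x s) (x :: s).
Proof. by rewrite /insert_part perm_sort. Qed.

Lemma size_insert_part x s : size (insert_part x s) = (size s).+1.
Proof. by rewrite (perm_size (perm_insert_part x s)). Qed.

Lemma mem_insert_part x s : insert_part x s =i x :: s.
Proof. exact/perm_mem/perm_insert_part. Qed.

Lemma insert_part_sorted x s : sorted geq (insert_part x s).
Proof. by apply: sort_sorted => y z; apply: leq_total. Qed.

Lemma sumn_perm s t : perm_eq s t -> sumn s = sumn t.
Proof. by move=> st; rewrite !sumnE; apply: perm_big. Qed.

Lemma is_part_insert n x s :
  0 < x -> is_part_of n s -> is_part_of (x + n) (insert_part x s).
Proof.
move=> x0 /and3P[_ s_pos /eqP<-]; apply/and3P; split.
- exact: insert_part_sorted.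
- by rewrite (perm_all _ (perm_insert_part x s)) /= x0.
- by rewrite (sumn_perm (perm_insert_part x s)).
Qed.

Lemma is_part_rem n x s :
  x \in s -> is_part_of n s -> is_part_of (n - x) (rem x s).
Proof.
move=> xs /and3P[s_sort s_pos /eqP<-]; apply/and3P; split.
- apply: subseq_sorted (rem_subseq x s) s_sort => y z t yz ty.
  exact: leq_trans ty yz.
- by apply/allP => y /mem_rem; apply: (allP s_pos).
- by rewrite (sumn_perm (perm_to_rem xs)) /= addKn.
Qed.

Lemma insert_partK n x s : is_part_of n s -> rem x (insert_part x s) = s.
Proof.
case/and3P=> s_sort _ _; have xI: x \in insert_part x s.
  by rewrite mem_insert_part mem_head.
apply: geq_sorted_eq => //.
  apply: subseq_sorted (rem_subseq x _) (insert_part_sorted x s) => y z t yz ty.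
  exact: leq_trans ty yz.
rewrite -(perm_cons x) perm_sym; apply: perm_trans (perm_to_rem xI).
by rewrite perm_sym perm_insert_part.
Qed.

Lemma rem_partK n x s :
  x \in s -> is_part_of n s -> insert_part x (rem x s) = s.
Proof.
move=> xs /and3P[s_sort _ _]; apply: geq_sorted_eq => //.
  exact: insert_part_sorted.
by apply: perm_trans (perm_insert_part _ _) _; rewrite perm_sym perm_to_rem.
Qed.

(** * Adding 1 to every part *)

Lemma sumn_map_succn s : sumn (map succn s) = sumn s + size s.
Proof. by elim: s => //= x s ->; lia. Qed.

Lemma is_part_map_succn n s :
  is_part_of n s -> is_part_of (n + size s) (map succn s) /\ 1 \notin map succn s.
Proof.
case/and3P=> s_sort s_pos /eqP<-; split; last first.
  by apply/mapP=> -[x /(allP s_pos) + [x0]]; rewrite -x0.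
apply/and3P; split; last by rewrite sumn_map_succn.
  by rewrite sorted_map (eq_sorted (e' := geq)).
by rewrite all_map; apply/allP.
Qed.

Lemma map_succnK s : map predn (map succn s) = s.
Proof. by rewrite mapK. Qed.

Lemma map_prednK n t :
  is_part_of n t -> map succn (map predn t) = t.
Proof.
case/and3P=> _ /allP t_pos _; rewrite -map_comp map_id_in // => x /t_pos /=.
exact: prednK.
Qed.

Lemma is_part_map_predn n t : is_part_of n t -> 1 \notin t ->
  is_part_of (n - size t) (map predn t).
Proof.
move=> t_part t1; have tK := map_prednK t_part.
case/and3P: t_part => t_sort t_pos /eqP<-; apply/and3P; split.
- by move: t_sort; rewrite -{1}tK sorted_map (eq_sorted (e' := geq)).
- rewrite all_map; apply/allP => -[|[|x]] // xt.
    by have := allP t_pos _ xt.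
  by rewrite xt in t1.
- by rewrite -{2}tK sumn_map_succn size_map addnK.
Qed.

(** * Partitions without a part equal to 1 *)

Definition num_no1 n := \sum_(l : intpart n | 1 \notin parts l) 1.

Lemma pnum_sum (n : nat) : pnum n = \sum_(l : intpart n) 1.
Proof. by rewrite sum1_card. Qed.

(** The invariance hypothesis on [P] makes deletion of one part [x] a bijection
between the two sets being counted; it is used with [P] always true, and with
[P] the absence of the part 1 when [x > 1]. *)
Lemma num_with_part n x (P : pred (seq nat)) : 0 < x ->
    (forall s, P (insert_part x s) = P s) ->
  \sum_(l : intpart (x + n) | P l && (x \in parts l)) 1 =
  \sum_(l : intpart n | P l) 1.
Proof.
move=> x0 Px.
apply: (sum_intpart_bij (P := fun s => P s && (x \in s)) (F := rem x)
  (G := insert_part x) (h := fun=> 1) (k := fun=> 1)) => s s_part.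
  case/andP=> Ps xs; have sK := rem_partK xs s_part.
  split=> //; last by rewrite -Px sK.
  by have := is_part_rem xs s_part; rewrite addKn.
move=> Ps; split; first exact: is_part_insert.
  by rewrite Px Ps mem_insert_part mem_head.
exact: insert_partK s_part.
Qed.

Lemma num_no1S (n : nat) : num_no1 n.+1 + pnum n = pnum n.+1.
Proof.
rewrite !pnum_sum (bigID (fun l : intpart n.+1 => 1 \in parts l)) /= addnC.
by congr (_ + _); have := @num_with_part n 1 predT isT (fun=> erefl).
Qed.

Lemma pnum0 : pnum 0 = 1.
Proof.
rewrite /= -(card1 (IntPart (isT : is_part_of 0 [::]))); apply: eq_card => l.
apply/esym/eqP/val_inj/nilP; have := size_intpart l; rewrite leqn0 => /eqP E.
by rewrite /nilp E.
Qed.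

Lemma num_no1_0 : num_no1 0 = 1.
Proof.
rewrite -pnum0 pnum_sum; apply: eq_bigl => l.
by apply/negP => /mem_intpart_le.
Qed.

Lemma sum_num_no1 (n : nat) : \sum_(j < n.+1) num_no1 j = pnum n.
Proof.
elim: n => [|n IHn]; first by rewrite big_ord1 num_no1_0 pnum0.
by rewrite big_ord_recr /= IHn addnC num_no1S.
Qed.

(** * Partitions containing their own length *)

(** Deleting the part equal to the length [m] and adding 1 to the [m - 1]
remaining parts changes the size by [- m + (m - 1) = - 1], whatever [m] is. *)
Lemma num_own_length n :
  \sum_(l : intpart n.+1 | size l \in parts l) 1 = num_no1 n.
Proof.
apply: (sum_intpart_bij (P := fun s => size s \in s)
  (Q := fun s => 1 \notin s)
  (F := fun s => map succn (rem (size s) s))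
  (G := fun t => insert_part (size t).+1 (map predn t))
  (h := fun=> 1) (k := fun=> 1)) => s s_part.
  move=> ls; have [+ ->] := is_part_map_succn (is_part_rem ls s_part).
  have s_gt0 : 0 < size s by case: (s) ls.
  rewrite size_map map_succnK size_rem // prednK // (rem_partK ls s_part).
  have le_s : size s <= n.+1.
    by case/and3P: s_part => _ + /eqP<-; apply: size_le_sumn.
  by have -> : n.+1 - size s + (size s).-1 = n by lia.
move=> s1; have p_part := is_part_map_predn s_part s1.
have sK := map_prednK s_part.
have le_s : size s <= n.
  by case/and3P: s_part => _ + /eqP<-; apply: size_le_sumn.
rewrite size_insert_part size_map (insert_partK _ p_part); split=> //.
  by have := is_part_insert (ltn0Sn (size s)) p_part; rewrite addSn subnKC.
by rewrite mem_insert_part mem_head.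
Qed.

Lemma e_succ (n : nat) : e n.+1 + num_no1 n = pnum n.+1.
Proof.
rewrite pnum_sum (bigID (fun l : intpart n.+1 => size l \in parts l)) /=.
by rewrite num_own_length addnC /e cardsE sum1_card.
Qed.

Lemma e0 : e 0 = pnum 0.
Proof.
rewrite /e /= cardsE; apply: eq_card => l; rewrite !inE.
apply/negP => l_in; have := mem_intpart_le l_in.
by case/and3P: (partsP l) => _ /allP /(_ _ l_in) /= + _; lia.
Qed.

(** * Part sizes of partitions of given rank *)

Lemma size_undup_map_inj (f : nat -> nat) s :
  injective f -> size (undup (map f s)) = size (undup s).
Proof. by move=> f_inj; rewrite undup_map_inj ?size_map. Qed.

(** Rank [n + 1] ties the largest part to the number of parts, so no
information is lost by deleting it; it is larger than the sum of all other
parts, so it always contributes exactly one part size. *)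
Lemma f_no1 n :
  f n = \sum_(l : intpart n | 1 \notin parts l) (size (undup l)).+1.
Proof.
apply: (sum_intpart_bij
  (P := fun s => ((head 0%N s)%:Z - (size s)%:Z == n%:Z + 1)%R)
  (Q := fun s => 1 \notin s)
  (F := fun s => map succn (behead s))
  (G := fun t => (n + (size t).+2) :: map predn t)
  (h := fun s => size (undup s))
  (k := fun t => (size (undup t)).+1)) => [s s_part|t t_part t1].
  case: s s_part => [_ /eqP /=|x s]; first by lia.
  case/and3P=> /= x_path /andP[x0 s_pos] /eqP sum_s /eqP rank_s.
  have s_part : is_part_of (sumn s) s.
    by apply/and3P; split=> //; apply: path_sorted x_path.
  have [S_part S1] := is_part_map_succn s_part.
  have x_def : x = n + (size s).+2 by lia.
  have sum_n : sumn s + size s = n by lia.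
  rewrite sum_n in S_part; split=> //.
    by rewrite map_succnK size_map -x_def.
  rewrite size_undup_map_inj; last exact: succn_inj.
  by rewrite ifN //; apply/negP => /mem_le_sumn; lia.
have p_part := is_part_map_predn t_part t1; have tK := map_prednK t_part.
have le_t : size t <= n.
  by case/and3P: t_part => _ + /eqP<-; apply: size_le_sumn.
split; [|by rewrite /= size_map; apply/eqP; lia|by []].
case/and3P: p_part => p_sort p_pos /eqP sum_p; apply/and3P; split.
- rewrite /= path_min_sorted //; apply/allP => y /mem_le_sumn.
  by rewrite sum_p /=; lia.
- by rewrite /= p_pos; lia.
- by rewrite /= sum_p; lia.
Qed.

Lemma size_undup_sum m s : (forall x, x \in s -> 1 < x < m.+2) ->
  size (undup s) = \sum_(j < m) (j.+2 \in s).
Proof.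
move=> s_bnd; have perm_s : perm_eq (undup s) [seq x <- iota 2 m | x \in s].
  apply: uniq_perm => [||x]; rewrite ?undup_uniq ?filter_uniq ?iota_uniq //.
  rewrite mem_undup mem_filter mem_iota add2n.
  by case: (boolP (x \in s)) => // /s_bnd.
rewrite (perm_size perm_s) size_filter -sum1_count big_mkcond /=.
rewrite (iotaDl 2 0) big_map -{1}[m]subn0 -/(index_iota 0 m) big_mkord.
by apply: eq_bigr => j _; rewrite add2n; case: (_ \in _).
Qed.

(** Double counting: the partitions of [n] without 1 that contain a given
[k >= 2] are, after deletion of [k], those of [n - k] without 1.  Here
[k = j + 2], and the order of summation is reversed so that [n - k] becomes the
index.  For [n <= 1] both sides are 0, by the truncated predecessor. *)
Lemma sum_sizes_no1 n :
  \sum_(l : intpart n | 1 \notin parts l) size (undup l) =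
  \sum_(j < n.-1) num_no1 j.
Proof.
have size_sum (l : intpart n) : 1 \notin parts l ->
    size (undup l) = \sum_(j < n.-1) (j.+2 \in parts l).
  move=> l1; apply: size_undup_sum => x x_in.
  have le_xn := mem_intpart_le x_in.
  case/and3P: (partsP l) => _ /allP/(_ _ x_in) /= x0 _.
  have x1 : x != 1 by apply: contraNneq l1 => <-.
  by lia.
rewrite (eq_bigr _ size_sum) exchange_big /=.
rewrite (reindex_inj rev_ord_inj) /=; apply: eq_bigr => j _.
have def_n : n = (n.-1 - j.+1).+2 + j by have := ltn_ord j; lia.
rewrite [RHS]/num_no1.
rewrite -(@num_with_part j (n.-1 - j.+1).+2 (fun s => 1 \notin s)) //.
  rewrite -def_n [RHS]big_mkcondr /=.
  by apply: eq_bigr => l _; case: (_ \in _).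
by move=> s; rewrite mem_insert_part.
Qed.

Theorem theorem4p3 (n : nat) :
  ((e n)%:Z = (pnum n%:Z)%:Z - (pnum (n%:Z - 1))%:Z + (pnum (n%:Z - 2))%:Z
  /\ (pnum n%:Z)%:Z - (pnum (n%:Z - 1))%:Z + (pnum (n%:Z - 2))%:Z = (f n)%:Z)%R.
Proof.
have -> : f n = num_no1 n + \sum_(j < n.-1) num_no1 j.
  by rewrite f_no1 -sum_sizes_no1 -big_split.
case: n => [|[|n]].
- by rewrite e0 big_ord0 num_no1_0 pnum0.
- rewrite (_ : 1%:Z - 1 = 0%:Z)%R // (_ : 1%:Z - 2 = Negz 0)%R //.
  have := e_succ 0; have := num_no1S 0; rewrite num_no1_0 pnum0 big_ord0 /=.
  by lia.
- rewrite (_ : n.+2%:Z - 1 = n.+1%:Z)%R; last by lia.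
  rewrite (_ : n.+2%:Z - 2 = n%:Z)%R; last by lia.
  rewrite sum_num_no1.
  by have := e_succ n.+1; have := num_no1S n; have := num_no1S n.+1; lia.
Qed.
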